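(* For every positive integer $m$, let $$\ell_m=\min_{A\in \mathcal{H}_m}\left\{ m^{-1}\sum_{n\in \mathbb{Z}_m}\sigma_A(n)\right\},$$ where $\mathcal{H}_m$ is the set of subsets $A\subseteq \mathbb{Z}_m$ such that $\sigma_A(n)\geq 1$ for all $n\in\mathbb{Z}_m$. Then $$\limsup_{m\rightarrow\infty}\ell_m\leq 144.$$
   Context: For a positive integer $m$, $\mathbb{Z}_m$ denotes the set of residue classes modulo $m$. For $A\subseteq\mathbb{Z}_m$ and $n\in\mathbb{Z}_m$, $\sigma_A(n)$ denotes the number of ordered pairs $(x,y)$ with $x,y\in A$ and $n=x+y$ in $\mathbb{Z}_m$. *)

(* Defs.v *)
From mathcomp Require Import all_boot all_order all_algebra.
From mathcomp Require Import reals.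
Set Implicit Arguments.
Unset Strict Implicit.
Unset Printing Implicit Defensive.
Import Order.TTheory GRing.Theory Num.Theory.
Local Open Scope ring_scope.

(* 'I_n.+1 carries addition modulo n.+1, and m.-1.+1 = m for m > 0.  The
   library's 'Z_m is avoided because 'Z_1 has two elements.  (Zmod 0 is a
   dummy value, equal to Zmod 1.) *)
Notation Zmod m := 'I_m.-1.+1.

Definition sigma (m : nat) (A : {set Zmod m}) (n : Zmod m) : nat :=
  #|[set p : Zmod m * Zmod m | [&& p.1 \in A, p.2 \in A & n == p.1 + p.2]]|.

Definition calH (m : nat) : {set {set Zmod m}} :=
  [set A : {set Zmod m} | [forall n, (1 <= sigma A n)%N]].

Definition mean_sigma (R : realType) (m : nat) (A : {set Zmod m}) : R :=
  m%:R^-1 * \sum_(n : Zmod m) (sigma A n)%:R.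

(* The starting value [set: Zmod m] only serves as a witness that calH m is
   nonempty (setT_in_calH); by ell_attained and ell_le, ell R m is the minimum of
   mean_sigma over calH m. *)
Definition ell (R : realType) (m : nat) : R :=
  mean_sigma R [arg min_(A < [set: Zmod m] in calH m) mean_sigma R A]%O.

Lemma setT_in_calH (m : nat) : [set: Zmod m] \in calH m.
Proof.
rewrite inE; apply/forallP => n; rewrite card_gt0; apply/set0Pn.
by exists (n, 0); rewrite !inE /= addr0.
Qed.

Lemma ell_attained (R : realType) (m : nat) :
  exists2 A, A \in calH m & ell R m = mean_sigma R A.
Proof.
rewrite /ell; case: arg_minP => [|A HA _]; first exact: setT_in_calH.
by exists A.
Qed.

Lemma ell_le (R : realType) (m : nat) (A : {set Zmod m}) :
  A \in calH m -> ell R m <= mean_sigma R A.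
Proof.
rewrite /ell; case: arg_minP => [|B _ minB]; first exact: setT_in_calH.
exact: minB.
Qed.

(* Main.v *)
(** Take k with k^2 <= m < (k+1)^2.  Euclidean division by k shows that the
    residues below k together with the first k+3 multiples of k form an additive
    basis of order 2 of Z_m.  It has at most 2k+3 <= 5k elements, so its mean
    representation number |A|^2 / m is at most 25. *)
Require Import Defs.
From mathcomp Require Import all_boot all_order all_algebra.
From mathcomp Require Import reals constructive_ereal sequences.
From mathcomp Require Import ereal normedtype.
From mathcomp Require Import zify.
Import Order.TTheory GRing.Theory Num.Theory.
Local Open Scope ring_scope.

(** Double counting: each ordered pair in A x A is counted at exactly one n, its own sum. *)
Lemma sum_sigma (m : nat) (A : {set Zmod m}) :
  (\sum_(n : Zmod m) sigma A n = #|A| ^ 2)%N.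
Proof.
rewrite -mulnn -cardsX -sum1_card.
rewrite (partition_big (fun p : Zmod m * Zmod m => p.1 + p.2) predT) //=.
apply: eq_bigr => n _; rewrite /sigma -sum1_card; apply: eq_bigl => p.
by rewrite !inE -andbA (eq_sym n).
Qed.

Lemma mean_sigmaE (R : realType) (m : nat) (A : {set Zmod m}) :
  mean_sigma R A = (#|A| ^ 2)%:R / m%:R.
Proof. by rewrite /mean_sigma -natr_sum sum_sigma mulrC. Qed.

Lemma exists_sqrtn (m : nat) : exists k, (k ^ 2 <= m < k.+1 ^ 2)%N.
Proof.
elim: m => [|m [k /andP[km mk]]]; first by exists 0%N.
have [lt_mk|] := ltnP m.+1 (k.+1 ^ 2); first by exists k; rewrite lt_mk leqW.
by move=> le_km; exists k.+1; rewrite le_km; move: mk; rewrite -!mulnn; lia.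
Qed.

(** Where j * k >= m, [inord] gives its default value 0, not the residue; the representations below
    only use multiples that are at most n < m. *)
Definition division_basis (m k : nat) : {set Zmod m} :=
  [set inord i | i : 'I_k] :|: [set inord (j * k) | j : 'I_k.+3].

Lemma card_division_basis (m k : nat) :
  (0 < k)%N -> (#|division_basis m k| <= 5 * k)%N.
Proof.
move=> k_gt0; rewrite /division_basis.
apply: leq_trans (leq_card_setU _ _).1 _.
apply: (@leq_trans (k + k.+3)); last by lia.
by apply: leq_add; apply: leq_trans (leq_imset_card _ _) _; rewrite card_ord.
Qed.

Lemma division_basis_calH (m k : nat) :
  (0 < k)%N -> (0 < m < k.+1 ^ 2)%N -> division_basis m k \in calH m.
Proof.
move=> k_gt0 /andP[m_gt0 mk]; rewrite inE; apply/forallP => n.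
have lt_nm : (n < m)%N by rewrite -[ltnRHS](prednK m_gt0).
(* Since k >= 1, n < (k+1)^2 = k^2 + 2k + 1 <= (k+3)k. *)
have lt_q : (n %/ k < k.+3)%N by rewrite ltn_divLR //; move: mk; rewrite -mulnn; nia.
rewrite card_gt0; apply/set0Pn.
exists (inord (n %% k), inord (n %/ k * k)); rewrite !inE /=; apply/and3P; split.
- by apply/orP; left; apply/imsetP; exists (Ordinal (ltn_pmod n k_gt0)).
- by apply/orP; right; apply/imsetP; exists (Ordinal lt_q).
- have lt_n := ltn_ord n; apply/eqP/val_inj => /=.
  (* Both summands are at most n, so [inord] keeps them, and their sum is n already in the naturals:
     nothing wraps around. *)
  rewrite !inordK; first by rewrite addnC -divn_eq modn_small.
    exact: leq_ltn_trans (leq_divM _ _) lt_n.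
  exact: leq_ltn_trans (leq_mod _ _) lt_n.
Qed.

Lemma ell_le25 (R : realType) (m : nat) : ell R m <= 25.
Proof.
have [->|m_gt0] := posnP m.
  (* For m = 0 the mean is 0, because the inverse of 0 is 0. *)
  by have [A _ ->] := ell_attained R 0; rewrite mean_sigmaE invr0 mulr0 ler0n.
have [k /andP[km mk]] := exists_sqrtn m.
have k_gt0 : (0 < k)%N by case: k {km} mk => //; rewrite exp1n; lia.
have basis : division_basis m k \in calH m.
  by apply: division_basis_calH; rewrite ?m_gt0.
apply: le_trans (ell_le R basis) _.
rewrite mean_sigmaE ler_pdivrMr ?ltr0n // -natrM ler_nat.
have := card_division_basis m k k_gt0; move: km; rewrite -!mulnn; nia.
Qed.

Theorem theorem1 (R : realType) :
  (limn_esup (fun m : nat => (ell R m)%:E) <= 144%:E)%E.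
Proof.
rewrite limn_esup_lim; apply: lime_le; first exact: is_cvg_esups.
(* The uniform bound on [ell] bounds the supremum of every tail, hence the limit of these
   suprema. *)
apply: nearW => n; apply: ge_ereal_sup => _ [m _ <-].
by rewrite lee_fin (le_trans (ell_le25 R m)) // ler_nat.
Qed.
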